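(* Let $r,c,k$ be positive integers with $r$ even, let $\lambda=[(kc)^r,((k-1)c)^r,\ldots,c^r]$ be the generalized staircase, and let $i,j\ge0$ be integers with $\lambda[i,j]\neq[\,]$. Then $\lambda[i,j]$ is a $\mathcal P$-position (losing position) of the game King under normal play if and only if $$i\left(c\left(k-\left\lfloor \frac{i}{r}\right\rfloor\right)-j\right)$$ is odd.
   Context: A partition is a finite weakly decreasing sequence $\lambda=[\lambda_1,\ldots,\lambda_s]$ of positive integers (exponents denote repetition of parts; $[\,]$ is the empty partition). For $i,j\ge 0$, $\lambda[i,j]=[\lambda_{i+1}-j,\lambda_{i+2}-j,\ldots]$ with trailing nonpositive entries removed. King is the two-player impartial game whose positions are nonempty partitions; from $\mu$ a player may move to $\mu[a,b]$ for any $(a,b)\in\{(0,1),(1,0),(1,1)\}$ with $\mu[a,b]\ne[\,]$. Normal play: the player who cannot move loses. A position is a $\mathcal P$-position if no move from it leads to a $\mathcal P$-position (in particular terminal positions are $\mathcal P$); otherwise it is an $\mathcal N$-position. *)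

(* Defs.v *)
From mathcomp Require Import all_boot all_order all_algebra zify.

Set Implicit Arguments.
Unset Strict Implicit.
Unset Printing Implicit Defensive.

Definition is_partition (mu : seq nat) : bool :=
  sorted geq mu && all (leq 1) mu.

(* mu[i, j].  In a weakly decreasing sequence the entries that become
   nonpositive are trailing, so removing them amounts to filtering; the
   remaining subtractions are not truncated. *)
Definition shrink (mu : seq nat) (i j : nat) : seq nat :=
  [seq x - j | x <- drop i mu & j < x].

Lemma shrink_partition (mu : seq nat) (i j : nat) :
  is_partition mu -> is_partition (shrink mu i j).
Proof.
case/andP=> srt _; apply/andP; split; last first.
  by apply/allP => y /mapP [x]; rewrite mem_filter => /andP [h _] ->; rewrite subn_gt0.
have tr : transitive geq by move=> y x z /= h1 h2; exact: leq_trans h2 h1.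
apply: (@homo_sorted _ _ (fun x => x - j) geq geq).
  by move=> x y /= h; exact: leq_sub2r.
exact/(sorted_filter tr)/drop_sorted.
Qed.

(* King is played on nonempty partitions; king_moves mu lists the positions
   that can be reached from mu in one move. *)
Definition king_moves (mu : seq nat) : seq (seq nat) :=
  [seq nu <- [seq shrink mu ab.1 ab.2 | ab <- [:: (0, 1); (1, 0); (1, 1)]]
     | nu != [::]].

(* The recursion defining P-positions, with fuel n bounding the length of the
   play; king_P_positionE below shows that the fuel is immaterial. *)
Fixpoint king_P_rec (n : nat) (mu : seq nat) : bool :=
  if n is n'.+1 then ~~ has (king_P_rec n') (king_moves mu) else true.

Definition king_P_position (mu : seq nat) : bool :=
  king_P_rec (size mu + sumn mu) mu.

Lemma king_moves_decr (mu nu : seq nat) :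
  nu \in king_moves mu -> size nu + sumn nu < size mu + sumn mu.
Proof.
have le (j : nat) (s : seq nat) :
    size (shrink s 0 j) + sumn (shrink s 0 j) <= size s + sumn s.
  elim: s => [|x s]; rewrite /shrink ?drop0 //=.
  by case: ifP => /= _; lia.
have lt (s : seq nat) : shrink s 0 1 != [::] ->
    size (shrink s 0 1) + sumn (shrink s 0 1) < size s + sumn s.
  case: s => // x s _; have := le 1 s.
  by rewrite /shrink !drop0 /=; case: ifP => /= h; lia.
have shS (x : nat) (s : seq nat) (j : nat) : shrink (x :: s) 1 j = shrink s 0 j.
  by rewrite /shrink /= !drop0.
rewrite mem_filter => /andP [nz /mapP [[a b] hab eq_nu]]; subst nu.
move: hab nz; rewrite !inE => /or3P [] /eqP [-> ->] /=; first exact: lt.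
  by case: mu => // x s _; rewrite shS; have := le 0 s => /=; lia.
by case: mu => // x s _; rewrite shS; have := le 1 s => /=; lia.
Qed.

Lemma king_P_positionE (mu : seq nat) :
  king_P_position mu = ~~ has king_P_position (king_moves mu).
Proof.
have fuel m n nu : size nu + sumn nu <= m -> size nu + sumn nu <= n ->
    king_P_rec m nu = king_P_rec n nu.
  elim: m n nu => [|m IH] [|n] nu //=.
  - by case: nu.
  - by case: nu.
  move=> hm hn; congr (~~ _); apply: eq_in_has => x /king_moves_decr hx.
  by apply: IH; lia.
rewrite /king_P_position (fuel _ (size mu + sumn mu).+1) //=.
congr (~~ _); apply: eq_in_has => x /king_moves_decr hx.
by apply: fuel; lia.
Qed.

(* [(k c)^r, ((k-1) c)^r, ..., c^r] *)
Definition staircase (r c k : nat) : seq nat :=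
  flatten [seq nseq r (a * c) | a <- rev (iota 1 k)].

Lemma staircase_partition (r c k : nat) :
  0 < c -> is_partition (staircase r c k).
Proof.
move=> c0.
have SE n : staircase r c n.+1 = nseq r (n.+1 * c) ++ staircase r c n.
  rewrite /staircase -(addn1 n) iotaD rev_cat map_cat flatten_cat /= cats0.
  by rewrite add1n addn1.
have bnd n : all (fun x => 0 < x <= n * c) (staircase r c n).
  elim: n => [|n IH] //; rewrite SE all_cat all_nseq leqnn muln_gt0 c0 orbT /=.
  by apply: sub_all IH => x /andP [-> /= h]; rewrite (leq_trans h) ?leq_mul.
have tr : transitive geq by move=> y x z /= h1 h2; exact: leq_trans h2 h1.
apply/andP; split; last by apply: sub_all (bnd k) => x /andP [].
elim: k => [|k IH] //; rewrite SE (sorted_pairwise tr) pairwise_cat.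
rewrite -!(sorted_pairwise tr) IH andbT; apply/andP; split.
  apply/allrelP => x y /nseqP [-> _] /(allP (bnd k)) /andP [_ h] /=.
  by rewrite (leq_trans h) ?leq_mul.
by case: r {IH SE bnd} => //= r; elim: r => //= r ->; rewrite leqnn.
Qed.

(* Main.v *)
Require Import Defs.
From mathcomp Require Import all_boot all_order all_algebra.
From mathcomp Require Import zify.

Set Implicit Arguments.
Unset Strict Implicit.
Unset Printing Implicit Defensive.

(* A nonempty [s[i, j]] is losing iff both [i] and [s_(i+1) - j] are odd.  The
   parts of [s] come in pairs of equal ones, so a move that changes an even [i]
   to [i + 1] keeps the same part: from a position that is not odd/odd, the move
   that corrects exactly the wrong parities is legal, and every move from an
   odd/odd position spoils one of the two parities. *)

Lemma geq_trans : transitive geq.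
Proof. by move=> y x z /= h1 h2; exact: leq_trans h2 h1. Qed.

(** The first entry left after [drop i] is the largest, so it alone decides emptiness. The default 0
    covers [i] beyond the end. *)
Lemma shrink_eq_nil (s : seq nat) (i j : nat) :
  sorted geq s -> (shrink s i j == [::]) = (nth 0 s i <= j).
Proof.
move=> /(drop_sorted i); rewrite -[i in nth 0 s i]addn0 -nth_drop /shrink.
case: (drop i s) => [|x t] //= /(order_path_min geq_trans) xt.
case: (ltnP j x) => //= xj.
rewrite (eq_in_filter (a2 := pred0)) ?filter_pred0 //= => y yt.
by have /= := allP xt y yt; lia.
Qed.

(** In a weakly decreasing sequence the entries above [j] form an initial segment. *)
Lemma drop_filter_gtn (s : seq nat) (a j : nat) :
  sorted geq s ->
  drop a [seq x <- s | j < x] = [seq x <- drop a s | j < x].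
Proof.
elim: s a => [|x s IH] [|a] //= /[dup] /path_sorted srt xs; first by rewrite drop0.
case: ifP => [_|xj]; first exact: IH.
have nil : [seq y <- s | j < y] = [::].
  rewrite (eq_in_filter (a2 := pred0)) ?filter_pred0 //= => y ys.
  by have /= := allP (order_path_min geq_trans xs) y ys; lia.
by rewrite -IH // nil.
Qed.

Lemma shrink_shrink (s : seq nat) (i j a b : nat) :
  sorted geq s -> shrink (shrink s i j) a b = shrink s (i + a) (j + b).
Proof.
move=> srt; rewrite /shrink -map_drop drop_filter_gtn ?drop_sorted //.
rewrite drop_drop addnC filter_map -map_comp -filter_predI.
rewrite (eq_filter (a2 := fun x => j + b < x)); last by move=> x /=; lia.
by apply: eq_map => x /=; lia.
Qed.

(** As shrinks compose, play stays among pairs [(i, j)] over a fixed [s], and one part decides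
    whether a move is legal. *)
Lemma has_king_moves_shrink (P : pred (seq nat)) (s : seq nat) (i j : nat) :
  sorted geq s ->
  has P (king_moves (shrink s i j)) =
    [|| (j.+1 < nth 0 s i) && P (shrink s i j.+1),
        (j < nth 0 s i.+1) && P (shrink s i.+1 j)
      | (j.+1 < nth 0 s i.+1) && P (shrink s i.+1 j.+1)].
Proof.
move=> srt; rewrite /king_moves has_count count_filter -has_count /=.
by rewrite !shrink_shrink // !shrink_eq_nil // !addn0 !addn1 -!ltnNge orbF
           ![P _ && _]andbC.
Qed.

Lemma king_P_position_shrink (s : seq nat) (i j : nat) :
  sorted geq s -> (forall n, ~~ odd n -> nth 0 s n.+1 = nth 0 s n) ->
  j < nth 0 s i ->
  king_P_position (shrink s i j) = odd i && odd (nth 0 s i - j).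
Proof.
move=> srt pairs.
(* Raising [i] lowers the first summand, as [i < size s], and does not raise the second; raising [j]
   alone lowers the second. *)
have [m] := ubnP (size s - i + (nth 0 s i - j)).
elim: m i j => // m IH i j lt_m ji.
have i_s : i < size s by case: (ltnP i (size s)) ji => // /(nth_default 0) ->.
have le_nth : nth 0 s i.+1 <= nth 0 s i.
  have [i1|/(nth_default 0) -> //] := ltnP i.+1 (size s).
  exact: (sortedP 0 srt).
rewrite king_P_positionE has_king_moves_shrink //.
have -> : (j.+1 < nth 0 s i) && king_P_position (shrink s i j.+1) =
    (j.+1 < nth 0 s i) && (odd i && odd (nth 0 s i - j.+1)).
  by apply: andb_id2l => h; apply: IH => //; lia.
have down b : j <= b ->
    (b < nth 0 s i.+1) && king_P_position (shrink s i.+1 b) =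
    (b < nth 0 s i.+1) && (odd i.+1 && odd (nth 0 s i.+1 - b)).
  by move=> jb; apply: andb_id2l => h; apply: IH => //; lia.
(* A positive even difference is at least 2, so the move that raises [j] to make it odd is legal. *)
rewrite !down //=; have := pairs i; case: (odd i) => /= [_|/(_ isT) ->]; lia.
Qed.

(** Skipping the first block lowers [k] and the quotient by 1 each. Past the last block, truncated
    subtraction yields the default 0. *)
Lemma nth_staircase (r c k i : nat) :
  0 < r -> nth 0 (staircase r c k) i = (k - i %/ r) * c.
Proof.
move=> r0; elim: k i => [|k IH] i; first by rewrite /staircase nth_nil.
have -> : staircase r c k.+1 = nseq r (k.+1 * c) ++ staircase r c k.
  by rewrite /staircase -(addn1 k) iotaD rev_cat map_cat /= add1n addn1.
rewrite nth_cat size_nseq nth_nseq; case: ltnP => ir.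
  by rewrite divn_small.
by rewrite IH -{2}(subnK ir) divnDr ?divnn ?r0 ?addn1 ?subSS.
Qed.

Theorem corollary3p12 (r c k i j : nat)
    (hr : 0 < r) (hc : 0 < c) (hk : 0 < k) (r_even : ~~ odd r)
    (hne : shrink (staircase r c k) i j <> [::]) :
  king_P_position (shrink (staircase r c k) i j) <->
  odd `|(i%:Z * (c%:Z * (k%:Z - (i %/ r)%N%:Z) - j%:Z))%R|%N.
Proof.
have /andP [srt _] := staircase_partition r k hc.
have pairs n : ~~ odd n ->
    nth 0 (staircase r c k) n.+1 = nth 0 (staircase r c k) n.
  (* The even [r] cannot divide the odd [n.+1], so both indices lie in the same block. *)
  move=> n_even; rewrite !nth_staircase // divnS //.
  case: (boolP (r %| n.+1)) => // rn.
  by have := dvdn_odd rn; rewrite /= n_even => /(_ isT); rewrite (negbTE r_even).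
have ji : j < nth 0 (staircase r c k) i.
  by rewrite ltnNge -shrink_eq_nil //; apply/eqP.
rewrite king_P_position_shrink // nth_staircase //.
rewrite nth_staircase // in ji.
(* Nonemptiness makes both subtractions exact, so the integer expression is a product of two
   naturals. *)
have qk : i %/ r <= k by case: (leqP k (i %/ r)) ji => [/eqP->|/ltnW].
have -> : (c%:Z * (k%:Z - (i %/ r)%N%:Z) - j%:Z)%R =
    Posz ((k - i %/ r) * c - j).
  by rewrite -!subzn ?(ltnW ji) // PoszM -subzn // GRing.mulrC.
by rewrite -PoszM absz_nat oddM.
Qed.
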